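(* Let $H$ be an almost normal subgroup of a group $G$ and let $1\to G\to E\xrightarrow{\pi}\Gamma\to 1$ be a group extension consistent with the Hecke pair $(G,H)$, with consistent cross-section $\sigma:\Gamma\to E$, and let $E_\sigma=G\times\Gamma$ be the corresponding decomposition of $E$. Assume $L_0$, $L$ and $L_1$ are length functions on the Hecke pair $(G,H)$, the Hecke pair $(E,H)$ and the group $\Gamma$, respectively, such that: (i) the Hecke pair $(G,H)$ and the group $\Gamma$ have (RD) with respect to $L_0$ and $L_1$, respectively; and (ii) there are positive constants $c$ and $e$ such that $L_0(s)+L_1(\gamma)\leq c\,L(s,\gamma)^e$ for all $(s,\gamma)\in E_\sigma$. Then the Hecke pair $(E,H)$ has (RD) with respect to $L$.
   Context: All groups are discrete. A subgroup $H\leq G$ is almost normal if every double coset $HgH$ ($g\in G$) is a union of finitely many left cosets of $H$; then $(G,H)$ is called a Hecke pair. A length function on $G$ is a map $L:G\to[0,\infty)$ with $L(1)=0$, $L(g^{-1})=L(g)$ and $L(gh)\leq L(g)+L(h)$ for all $g,h\in G$; put $N_L=\{g\in G: L(g)=0\}$. A length function on a Hecke pair $(G,H)$ is a length function $L$ on $G$ with $H\subseteq N_L$ (so $L$ is constant on double cosets of $H$). $\mathcal{H}(G,H)$ is the space of finitely supported complex functions on the set of double cosets $G//H$, regarded as $H$-bi-invariant functions on $G$; elements of $\ell^2(H\backslash G)$ are regarded as left $H$-invariant functions on $G$. The regular representation $\lambda:\mathcal{H}(G,H)\to\mathcal{B}(\ell^2(H\backslash G))$ is $\lambda(f)(\xi)(g)=(f*\xi)(g)=\sum_{h\in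 H\backslash G} f(gh^{-1})\xi(h)$ (sum over representatives of right cosets). For $s\geq 0$, $\|f\|_{s,L}=\big(\sum_{g\in H\backslash G}|f(g)|^2(1+L(g))^{2s}\big)^{1/2}$. The Hecke pair $(G,H)$ has property (RD) with respect to a length function $L$ on $(G,H)$ if there are $C,s>0$ with $\|\lambda(f)\|\leq C\|f\|_{s,L}$ for all $f\in\mathcal{H}(G,H)$. Equivalently, there is a polynomial $P$ such that $\|f*k\|_2\leq P(r)\|f\|_2\|k\|_2$ for all $r>0$, all non-negative $f\in\mathcal{H}(G,H)$ supported on double cosets $HgH$ with $L(g)\leq r$, and all non-negative finitely supported $k$ on $H\backslash G$ (norms in $\ell^2(H\backslash G)$). A group $\Gamma$ has (RD) with respect to $L_1$ if the Hecke pair $(\Gamma,\{1\})$ does. Extensions: $G$ is viewed as a normal subgroup of $E$. A set-theoretic cross-section $\sigma:\Gamma\to E$ of $\pi$ with $\sigma(1_\Gamma)=1_E$ is consistent with $(G,H)$ if $\sigma(\gamma)H\sigma(\gamma)^{-1}=H$ for all $\gamma\in\Gamma$; the extension is consistent with $(G,H)$ if such a $\sigma$ exists. In this case $H$ is almost normal in $E$. Given $\sigma$, set $\rho(\gamma)(g)=\sigma(\gamma)g\sigma(\gamma)^{-1}$ and $f(\gamma_1,\gamma_2)=\sigma(\gamma_1)\sigma(\gamma_2)\sigma(\gamma_1\gamma_2)^{-1}\in G$. $E_\sigma$ is the set $G\times\Gamma$ with product $(g_1,\gamma_1)(g_2,\gamma_2)=(g_1\rho(\gamma_1)(g_2)f(\gamma_1,\gamma_2),\gamma_1\gamma_2)$;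 the map $(g,\gamma)\mapsto g\sigma(\gamma)$ is a group isomorphism $E_\sigma\to E$, and $L(s,\gamma)$ means $L(s\sigma(\gamma))$. *)

(* Defs.v *)
(* Discrete groups are [groupType]s (mathcomp.boot.monoid), the reals are an
   arbitrary [R : realType] and the complex numbers are [R[i]]. *)
From HB Require Import structures.
From mathcomp Require Import all_boot all_order all_algebra.
From mathcomp Require Import all_classical all_reals all_analysis.
From mathcomp Require Import complex.

Set Implicit Arguments.
Unset Strict Implicit.
Unset Printing Implicit Defensive.

Import Order.TTheory GRing.Theory Num.Theory.

Local Open Scope classical_set_scope.
Local Open Scope ring_scope.

Section HeckePairs.
Variable G : groupType.
Implicit Types (H : set G) (g : G).

Definition left_coset H g : set G := [set (g * h)%g | h in H].

Definition right_coset H g : set G := [set (h * g)%g | h in H].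

Definition double_coset H g : set G :=
  [set (h.1 * g * h.2)%g | h in H `*` H].

Definition almost_normal H : Prop :=
  forall g, exists2 X : set G, finite_set X &
    double_coset H g = \bigcup_(x in X) left_coset H x.

Definition hecke_pair H : Prop :=
  group_closed (mem H) /\ almost_normal H.

(* The coset space H \ G, as a set of subsets of G. *)
Definition right_cosets H : set (set G) := range (right_coset H).

(* A representative of a coset; functions on H \ G are left H-invariant
   functions on G, so they are evaluated on a coset through it. *)
Definition coset_repr (C : set G) : G := xget 1%g C.

End HeckePairs.

Section LengthFunctions.
Variables (R : realType) (G : groupType).

Record length_function (L : G -> R) : Prop := LengthFunction {
  length_ge0 : forall g, 0 <= L g;
  length1 : L 1%g = 0;
  lengthV : forall g, L g^-1%g = L g;
  lengthM : forall g h, L (g * h)%g <= L g + L h }.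

Definition length_kernel (L : G -> R) : set G := [set g | L g = 0].

Definition hecke_length (H : set G) (L : G -> R) : Prop :=
  length_function L /\ H `<=` length_kernel L.

End LengthFunctions.

Section RapidDecay.
Variables (R : realType) (G : groupType) (H : set G).
Implicit Types (f xi : G -> R[i]) (L : G -> R).

Local Notation modulus := (@Normc.normc R).

Definition left_invariant xi : Prop :=
  forall h g, H h -> xi (h * g)%g = xi g.

Definition bi_invariant f : Prop :=
  forall h g k, H h -> H k -> f (h * g * k)%g = f g.

Definition hecke_algebra : set (G -> R[i]) :=
  [set f | bi_invariant f /\
           finite_set [set double_coset H g | g in [set g | f g != 0]]].

Definition l2norm xi : \bar R :=
  ((\esum_(C in right_cosets H)
      (modulus (xi (coset_repr C)) ^+ 2)%:E) `^ 2^-1)%E.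

Definition l2space : set (G -> R[i]) :=
  [set xi | left_invariant xi /\ (l2norm xi < +oo)%E].

(* [\sum_(_ \in _)] adds up the nonzero terms when they are finitely many. For
   a Hecke pair they are: the support of [f] meets finitely many left cosets
   of [H], so [f (g h^-1)] vanishes outside finitely many cosets [H h]. *)
Definition convolution f xi : G -> R[i] := fun g =>
  \sum_(C \in right_cosets H)
    f (g * (coset_repr C)^-1)%g * xi (coset_repr C).

(* The norm of [lambda f] on l^2 (H \ G), [+oo] for an unbounded operator. *)
Definition regular_opnorm f : \bar R :=
  ereal_sup [set l2norm (convolution f xi) |
              xi in [set xi | l2space xi /\ (l2norm xi <= 1)%E]].

Definition weighted_norm (s : R) L f : \bar R :=
  ((\esum_(C in right_cosets H)
      (modulus (f (coset_repr C)) ^+ 2 *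
       (1 + L (coset_repr C)) `^ (2 * s))%:E) `^ 2^-1)%E.

Definition property_RD L : Prop :=
  exists C s : R, [/\ 0 < C, 0 < s & forall f, hecke_algebra f ->
    (regular_opnorm f <= C%:E * weighted_norm s L f)%E].

End RapidDecay.

Section GroupRapidDecay.
Variables (R : realType) (Gamma : groupType).

Definition group_RD (L : Gamma -> R) : Prop := property_RD [set 1%g] L.

End GroupRapidDecay.

Section Extensions.
Variables (G E Gamma : groupType).
Variables (iota : UMagmaMorphism.type G E).
Variables (pi : UMagmaMorphism.type E Gamma).

Definition group_extension : Prop :=
  [/\ injective iota, range iota = pi @^-1` [set 1%g]
    & range pi = [set: Gamma]].

Definition cross_section (sigma : Gamma -> E) : Prop :=
  cancel sigma pi /\ sigma 1%g = 1%g.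

(* [H] is identified with the subgroup [iota @` H] of [E]. *)
Definition consistent_section (H : set G) (sigma : Gamma -> E) : Prop :=
  cross_section sigma /\
  forall gamma, [set (sigma gamma * x * (sigma gamma)^-1)%g | x in iota @` H]
                = iota @` H.

(* The bijection from the set [G * Gamma] underlying E_sigma to [E]. *)
Definition Esigma_val (sigma : Gamma -> E) (x : G * Gamma) : E :=
  (iota x.1 * sigma x.2)%g.

End Extensions.

Lemma hecke_pair_extension (G E Gamma : groupType)
    (iota : UMagmaMorphism.type G E) (pi : UMagmaMorphism.type E Gamma)
    (H : set G) (sigma : Gamma -> E) :
  group_extension iota pi -> consistent_section iota pi H sigma ->
  hecke_pair H -> hecke_pair (iota @` H).
Proof.
move=> [_ kerE _] [[sK _] nHs] [[H1 HV] Han]; split.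
  split=> [|x y].
    by rewrite inE; exists 1%g; [rewrite inE in H1|rewrite gmulf1].
  rewrite !inE => -[h Hh <-] [k Hk <-]; exists (h / k)%g; last exact: gmulfF.
  by move: (HV h k); rewrite !inE; apply.
have sH gamma h : H h ->
    exists2 k, H k & (sigma gamma * iota h = iota k * sigma gamma)%g.
  move=> Hh; have : (iota @` H) (sigma gamma * iota h * (sigma gamma)^-1)%g.
    by rewrite -(nHs gamma); exists (iota h) => //; exists h.
  by move=> [k Hk e]; exists k; rewrite // e mulgVK.
have Hs gamma k : H k ->
    exists2 h, H h & (iota k * sigma gamma = sigma gamma * iota h)%g.
  move=> Hk; have : (iota @` H) (iota k) by exists k.
  by rewrite -{1}(nHs gamma) => -[_ [h Hh <-] <-]; exists h; rewrite // mulgVK.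
move=> g; set s := sigma (pi g).
have [g0 _ eg0] : range iota (g / s)%g.
  by rewrite kerE /= gmulfF /s sK divgg.
have {eg0} -> : g = (iota g0 * s)%g by rewrite eg0 mulgVK.
have [X finX dX] := Han g0.
exists [set (iota x * s)%g | x in X]; first exact: finite_image.
apply/seteqP; split=> [y [[_ _] [/= [h Hh <-] [k Hk <-]] <-]|y].
  have [k' Hk' ek] := sH (pi g) k Hk.
  have : double_coset H g0 (h * g0 * k')%g by exists (h, k').
  rewrite dX => -[x Xx [m Hm em]]; have [n Hn en] := Hs (pi g) m Hm.
  exists (iota x * s)%g; first by exists x.
  exists (iota n); first by exists n.
  by rewrite -mulgA -en mulgA -gmulfM em !gmulfM -!mulgA -ek.
move=> [_ [x Xx <-] [_ [n Hn <-] <-]].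
have [m Hm em] := sH (pi g) n Hn.
have : double_coset H g0 (x * m)%g by rewrite dX; exists x => //; exists m.
move=> [[h k] /= [Hh Hk] ehk]; have [k' Hk' ek] := Hs (pi g) k Hk.
exists (iota h, iota k') => /=; first by split; [exists h|exists k'].
by rewrite -[RHS]mulgA em [RHS]mulgA -(gmulfM x m) -ehk !gmulfM -!mulgA -ek.
Qed.

Lemma Esigma_val_bij (G E Gamma : groupType)
    (iota : UMagmaMorphism.type G E) (pi : UMagmaMorphism.type E Gamma)
    (sigma : Gamma -> E) :
  group_extension iota pi -> cross_section pi sigma ->
  bijective (Esigma_val iota sigma).
Proof.
move=> [inji kerE _] [sK _].
have pii x : pi (iota x) = 1%g.
  have : range iota (iota x) by exists x.
  by rewrite kerE.
rewrite -setTT_bijective; split => //.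
  move=> [x a] [y b] _ _; rewrite /Esigma_val /= => e.
  have eab : a = b by move/(congr1 pi): e; rewrite !gmulfM !pii !mul1g !sK.
  by subst b; move/mulIg: e => /inji ->.
move=> g _; have [x _ ex] : range iota (g / sigma (pi g))%g.
  by rewrite kerE /= gmulfF sK divgg.
by exists (x, pi g); rewrite // /Esigma_val /= ex mulgVK.
Qed.

(* Main.v *)
(* Since the l^2 and weighted norms only see moduli, (RD) can be tested on
   non-negative functions, where convolutions become unconditional sums in
   [0, +oo] and Tonelli applies. Slice a function on H \ E along the cosets
   (H \ G) sigma(gamma): the slice of F * xi at gamma is a sum over delta of
   convolutions, on G, of the slice of F at delta with a function having the
   l^2 norm of the slice of xi at delta^-1 gamma. Minkowski and (RD) of (G, H)
   bound its l^2 norm by the convolution, on Gamma, of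
   a(delta) = ||F_delta||_{s0,L0} and b(gamma) = ||xi_gamma||_2. Then (RD) of
   Gamma applies to a and b, and L0 + L1 <= c L^e turns the resulting weight
   (1 + L0)^(2 s0) (1 + L1)^(2 s1) into a power of 1 + L. *)
Require Import Defs.
From mathcomp Require Import all_boot all_order all_algebra.
From mathcomp Require Import finmap.
From mathcomp Require Import all_classical all_reals all_analysis.
From mathcomp Require Import complex.
From mathcomp Require Import ring.

Set Implicit Arguments.
Unset Strict Implicit.
Unset Printing Implicit Defensive.

Import Order.TTheory GRing.Theory Num.Theory.

Local Open Scope classical_set_scope.
Local Open Scope ring_scope.

(** * Unconditional sums in [0, +oo]: scaling, Tonelli, Cauchy-Schwarz, Minkowski *)

Section Esum.
Local Open Scope ereal_scope.
Variable R : realType.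

Lemma esum_ge_term (T : choiceType) (D : set T) (a : T -> \bar R) i :
  (forall j, D j -> 0 <= a j) -> D i -> a i <= \esum_(j in D) a j.
Proof.
move=> a0 Di; apply: esum_ge; exists [set i]; last by rewrite fsbig_set1.
by split; [exact: finite_set1|move=> _ ->].
Qed.

Lemma esum_eq0 (T : choiceType) (D : set T) (a : T -> \bar R) :
  (forall j, D j -> 0 <= a j) -> \esum_(j in D) a j <= 0 ->
  forall i, D i -> a i = 0.
Proof.
move=> a0 s0 i Di; apply/eqP; rewrite eq_le a0// andbT.
exact: le_trans (esum_ge_term a0 Di) s0.
Qed.

(** Finite subsums give one inequality; for a finite [c > 0] the other one is the same inequality
    with the factor [c^-1]. For [c = +oo], either every term vanishes or one nonzero term already
    makes the left-hand sum infinite. *)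
Lemma esumZl (T : choiceType) (D : set T) (c : \bar R) (a : T -> \bar R) :
  0 <= c -> (forall i, D i -> 0 <= a i) ->
  \esum_(i in D) (c * a i) = c * \esum_(i in D) a i.
Proof.
have le_Zl (b : T -> \bar R) (k : \bar R) : 0 <= k ->
    (forall i, D i -> 0 <= b i) ->
    \esum_(i in D) (k * b i) <= k * \esum_(i in D) b i.
  move=> k0 b0; apply: ge_ereal_sup => _ [X [finX XD] <-].
  have Xb i : X i -> 0 <= b i by move=> /XD /b0.
  rewrite fsbig_finite// big_seq_cond -ge0_sume_distrr -?big_seq_cond;
    last first.
    by move=> i; rewrite andbT in_fset_set// inE => /Xb.
  rewrite lee_wpmul2l// -fsbig_finite//.
  by apply: ereal_sup_ubound; exists X.
move=> c0 a0; apply/eqP; rewrite eq_le le_Zl//=.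
have ca0 i : D i -> 0 <= c * a i by move=> /a0 ?; exact: mule_ge0.
case: c c0 ca0 => [c| |//] c0 ca0.
  have [<-|cn] := eqVneq 0%R c.
    by rewrite mul0e esum_ge0// => i /a0; rewrite mul0e.
  have {cn}{}c0 : (0 < c)%R by rewrite lt_neqAle cn -lee_fin.

  rewrite [X in _ * X](_ : _ = \esum_(i in D) (c^-1%:E * (c%:E * a i))).
    rewrite (le_trans (lee_wpmul2l _ (le_Zl _ _ _ ca0)))//.
    - by rewrite lee_fin ltW.
    - by rewrite lee_fin invr_ge0 ltW.
    - by rewrite muleA -EFinM divff ?mul1e// gt_eqF.
  by apply: eq_esum => i _; rewrite muleA -EFinM mulVf ?mul1e// gt_eqF.
have [az|] := pselect (forall i, D i -> a i = 0).
  by rewrite !esum1 ?mule0// => i Di; rewrite az ?mule0.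
move=> /existsNP[i /not_implyP[Di /eqP ai]].
rewrite (le_trans (leey _))// (le_trans _ (esum_ge_term ca0 Di))//.
by rewrite gt0_mulye// lt0e ai a0.
Qed.

Lemma exchange_esum (T U : choiceType) (D : set T) (J : set U)
    (a : T -> U -> \bar R) : (forall i j, D i -> J j -> 0 <= a i j) ->
  \esum_(i in D) \esum_(j in J) a i j = \esum_(j in J) \esum_(i in D) a i j.
Proof.
move=> a0; rewrite !esum_esum//; last by move=> j i Jj Di; exact: a0.
rewrite (@reindex_esum _ _ _ (J `*`` fun=> D) _ (fun p => (p.2, p.1)))//.
by split => [[j i]|[j i] [j' i'] _ _ [-> ->]|[i j] [/= Di Jj]]//=;
  [case | exists (j, i)].
Qed.

Lemma esum_cauchy_schwarz (T : choiceType) (D : set T) (x y : T -> R)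
    (A B : R) : (0 <= A)%R -> (0 <= B)%R ->
  (forall i, D i -> 0 <= x i)%R -> (forall i, D i -> 0 <= y i)%R ->
  \esum_(i in D) (x i ^+ 2)%:E <= (A ^+ 2)%:E ->
  \esum_(i in D) (y i ^+ 2)%:E <= (B ^+ 2)%:E ->
  \esum_(i in D) (x i * y i)%:E <= (A * B)%:E.
Proof.
move=> A0 B0 x0 y0.
have sq0 (z : T -> R) j : D j -> 0 <= (z j ^+ 2)%:E by rewrite lee_fin sqr_ge0.
have vanish (z : T -> R) : \esum_(i in D) (z i ^+ 2)%:E <= (0 ^+ 2)%:E ->
    forall i, D i -> z i = 0%R.
  rewrite expr0n => z0 i Di; have := esum_eq0 (sq0 z) z0 Di.
  by move=> [] /eqP; rewrite sqrf_eq0 => /eqP.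
have [->{A A0}|An] := eqVneq A 0%R => sx.
  by move=> _; rewrite mul0r esum1// => i /(vanish _ sx) ->; rewrite mul0r.
have [->{B B0}|Bn] := eqVneq B 0%R => sy.
  by rewrite mulr0 esum1// => i /(vanish _ sy) ->; rewrite mulr0.
have A1 : (0 < A)%R by rewrite lt_neqAle eq_sym An.
have B1 : (0 < B)%R by rewrite lt_neqAle eq_sym Bn.
(* Weights for [x y <= p x^2 + q y^2]: [4 p q = 1] makes the difference a multiple of a square, and
   [p A^2 + q B^2 = A B]. *)
pose p := (B / (2 * A))%R; pose q := (A / (2 * B))%R.
have p0 : (0 <= p)%R by rewrite /p divr_ge0// mulr_ge0.
have q0 : (0 <= q)%R by rewrite /q divr_ge0// mulr_ge0.
apply: (@le_trans _ _
    (\esum_(i in D) (p%:E * (x i ^+ 2)%:E + q%:E * (y i ^+ 2)%:E))).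
  apply: le_esum => i Di; rewrite -!EFinM -EFinD lee_fin -subr_ge0.
  have -> : (p * x i ^+ 2 + q * y i ^+ 2 - x i * y i =
      (B * x i - A * y i) ^+ 2 / (2 * A * B))%R.
    by rewrite /p /q; field; rewrite An Bn.
  by rewrite divr_ge0 ?sqr_ge0// !mulr_ge0.
rewrite esumD; last 2 first.
  by move=> i Di; rewrite -EFinM lee_fin mulr_ge0// sqr_ge0.
  by move=> i Di; rewrite -EFinM lee_fin mulr_ge0// sqr_ge0.
rewrite !esumZl//; [|exact: sq0..].
apply: le_trans (leeD (lee_wpmul2l _ sx) (lee_wpmul2l _ sy)) _ => //.
rewrite -!EFinM -EFinD lee_fin le_eqVlt; apply/orP; left; apply/eqP.
by rewrite /p /q; field; rewrite An Bn.
Qed.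

(* Expanding both squares by Tonelli reduces the triangle inequality in l^2 to
   Cauchy-Schwarz for each pair of summands. *)
Lemma esum_minkowski (T U : choiceType) (D : set T) (J : set U)
    (f : U -> T -> \bar R) (N : U -> R) :
  (forall j i, 0 <= f j i) -> (forall j, 0 <= N j)%R ->
  (forall j, J j -> \esum_(i in D) f j i ^+ 2 <= (N j ^+ 2)%:E) ->
  \esum_(i in D) (\esum_(j in J) f j i) ^+ 2 <=
  (\esum_(j in J) (N j)%:E) ^+ 2.
Proof.
move=> f0 N0 fN.
have sqE (V : choiceType) (K : set V) (a : V -> \bar R) :
    (forall j, 0 <= a j) ->
    (\esum_(j in K) a j) ^+ 2 = \esum_(j in K) \esum_(k in K) (a j * a k).
  move=> a0; rewrite expe2 -esumZl//; last by rewrite esum_ge0.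
  apply: eq_esum => k _; rewrite muleC -esumZl//.
rewrite [leRHS]sqE//.
under eq_esum => i _ do rewrite sqE//.
rewrite exchange_esum; last first.
  by move=> *; rewrite esum_ge0// => *; rewrite mule_ge0.
apply: le_esum => j Jj.
rewrite exchange_esum; last by move=> *; rewrite mule_ge0.
apply: le_esum => k Jk.
(* The bound by [N l ^+ 2] forces every [f l i] to be finite, so Cauchy-Schwarz over the reals
   applies to [fine (f l i)]. *)
have ffin l i : J l -> D i -> f l i \is a fin_num.
  move=> Jl Di; rewrite ge0_fin_numE//.
  have := le_trans (esum_ge_term (fun i _ => expe_ge0 2 (f0 l i)) Di) (fN l Jl).
  by case: (f l i) (f0 l i) => [r _ _|_|//]; rewrite ?ltry// expe2 mulyy.
have sq l : J l ->
    \esum_(i in D) (fine (f l i) ^+ 2)%:E <= (N l ^+ 2)%:E.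
  move=> Jl; apply: le_trans (fN l Jl); apply: le_esum => i Di.
  by rewrite EFin_expe fineK ?ffin.
have fine0 l i : D i -> (0 <= fine (f l i))%R by rewrite fine_ge0.
apply: le_trans (esum_cauchy_schwarz (N0 j) (N0 k) (fine0 j) (fine0 k)
  (sq j Jj) (sq k Jk)).
by apply: le_esum => i Di; rewrite EFinM !fineK ?ffin.
Qed.

End Esum.

(** * Cosets, change of variables in coset sums, finite supports *)

Section Cosets.
Variables (G : groupType) (H : set G).
Hypothesis gH : group_closed (mem H).

Lemma subgroup1 : H 1%g.
Proof. by have [] := gH; rewrite inE. Qed.

Lemma subgroupV h : H h -> H h^-1%g.
Proof. by move=> Hh; have /(_ h) := group_closedV gH; rewrite !inE; apply. Qed.

Lemma subgroupM h k : H h -> H k -> H (h * k)%g.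
Proof.
by move=> Hh Hk; have /(_ h k) := group_closedM gH; rewrite !inE; apply.
Qed.

Lemma right_coset_eqP x y :
  right_coset H x = right_coset H y <-> exists2 h, H h & y = (h * x)%g.
Proof.
split=> [e|[h Hh ->]].
  have : right_coset H x y.
    by rewrite e; exists 1%g; [exact: subgroup1|rewrite mul1g].
  by move=> [h Hh <-]; exists h.
apply/seteqP; split=> [_ [k Hk <-]|_ [k Hk <-]].
  exists (k * h^-1)%g; first exact: (subgroupM Hk (subgroupV Hh)).
  by rewrite -mulgA mulKg.
by exists (k * h)%g; [exact: subgroupM|rewrite mulgA].
Qed.

Lemma coset_repr_right_coset x :
  exists2 h, H h & coset_repr (right_coset H x) = (h * x)%g.
Proof.
have : right_coset H x x by exists 1%g; [exact: subgroup1|rewrite mul1g].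
by move=> /(xgetI 1%g) [h Hh e]; exists h.
Qed.

Lemma coset_reprK C : right_cosets H C -> right_coset H (coset_repr C) = C.
Proof.
move=> [x _ <-]; apply/esym/right_coset_eqP.
exact: coset_repr_right_coset.
Qed.

Lemma left_coset_eqP x y :
  left_coset H x = left_coset H y <-> exists2 h, H h & y = (x * h)%g.
Proof.
split=> [e|[h Hh ->]].
  have : left_coset H x y.
    by rewrite e; exists 1%g; [exact: subgroup1|rewrite mulg1].
  by move=> [h Hh <-]; exists h.
apply/seteqP; split=> [_ [k Hk <-]|_ [k Hk <-]].
  exists (h^-1 * k)%g; first exact: (subgroupM (subgroupV Hh) Hk).
  by rewrite mulgA mulgK.
by exists (h * k)%g; [exact: subgroupM|rewrite mulgA].
Qed.

Lemma double_coset_refl x : double_coset H x x.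
Proof.
exists (1%g, 1%g) => /=; last by rewrite mul1g mulg1.
by split; exact: subgroup1.
Qed.

(** The chosen representative differs from [e i] by a left factor in [H], which [F] does not see.
    Later sums over cosets are evaluated on convenient representatives this way. *)
Lemma esum_right_cosets (R : realType) (T : choiceType) (D : set T) (e : T -> G)
    (S : set (set G)) (F : G -> \bar R) :
  set_bij D S (fun i => right_coset H (e i)) ->
  (forall h g, H h -> F (h * g)%g = F g) ->
  (\esum_(C in S) F (coset_repr C) = \esum_(i in D) F (e i))%E.
Proof.
move=> De FH; rewrite (@reindex_esum _ _ _ D S _ _ De); apply: eq_esum => i _.
by have [h Hh ->] := coset_repr_right_coset (e i); rewrite FH.
Qed.

(** Almost normality cuts each of the finitely many double cosets in the support into finitely many
    left cosets. *)
Lemma finite_left_cosets_support (R : realType) (f : G -> R[i]) :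
  almost_normal H -> hecke_algebra H f ->
  finite_set [set left_coset H g | g in [set g | f g != 0]].
Proof.
move=> anH [_ finf].
apply: (@sub_finite_set _ _ (\bigcup_(D in
    [set double_coset H g | g in [set g | f g != 0]]) left_coset H @` D)).
  move=> _ [g fg <-]; exists (double_coset H g); first by exists g.
  by exists g => //; exact: double_coset_refl.
apply: bigcup_finite => // _ [g _ <-].
have [X finX ->] := anH g.
apply: (@sub_finite_set _ _ (left_coset H @` X)); last exact: finite_image.
move=> _ [_ [x Xx [h Hh <-]] <-]; exists x => //.
by apply/left_coset_eqP; exists h.
Qed.

(** With [x = g c^-1], [c] the representative of [C], the coset [C] is recovered as [H x^-1 g] from
    the left coset [x H], and only finitely many left cosets meet the support. *)
Lemma finite_convolution_support (R : realType) (f : G -> R[i]) (g : G) :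
  almost_normal H -> hecke_algebra H f ->
  finite_set [set C | right_cosets H C /\ f (g * (coset_repr C)^-1)%g != 0].
Proof.
move=> anH Hf.
apply: (@sub_finite_set _ _
    ((fun K => right_coset H ((xget 1%g K)^-1 * g)%g) @`
      [set left_coset H g | g in [set g | f g != 0]])); last first.
  exact: finite_image (finite_left_cosets_support anH Hf).
move=> C [rC fC]; set x := (g * _)%g in fC.
exists (left_coset H x); first by exists x.
have : left_coset H x x by exists 1%g; [exact: subgroup1|rewrite mulg1].
move=> /(xgetI 1%g) [h Hh <-]; rewrite -[RHS](coset_reprK rC).
apply/right_coset_eqP; exists h => //.
by rewrite /x !invgM !invgK !mulgA mulgV mul1g mulgVK.
Qed.

End Cosets.

(** * Reduction of (RD) to non-negative functions *)

Section NonnegDecay.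
Variables (R : realType) (G : groupType) (H : set G).
Implicit Types (f xi : G -> R[i]) (phi u : G -> R) (L : G -> R).
Local Open Scope ereal_scope.

Local Notation modulus := (@Normc.normc R).

Definition nonneg_convolution phi u (g : G) : \bar R :=
  \esum_(C in right_cosets H)
    (phi (g * (coset_repr C)^-1)%g * u (coset_repr C))%:E.

(** (RD) with both sides squared; the reals [A] and [B] are upper bounds for the two norms, so that
    no square root or infinite norm occurs. *)
Definition nonneg_decay L (K s : R) : Prop :=
  forall phi u (A B : R),
    (forall g, 0 <= phi g)%R -> hecke_algebra H (real_complex R \o phi) ->
    (forall g, 0 <= u g)%R ->
    (forall h g, H h -> u (h * g)%g = u g) ->
    (0 <= A)%R -> (0 <= B)%R ->
    \esum_(C in right_cosets H)
      (phi (coset_repr C) ^+ 2 * (1 + L (coset_repr C)) `^ (2 * s))%:E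
      <= (A ^+ 2)%:E ->
    \esum_(C in right_cosets H) (u (coset_repr C) ^+ 2)%:E <= (B ^+ 2)%:E ->
    \esum_(C in right_cosets H) nonneg_convolution phi u (coset_repr C) ^+ 2
      <= ((K * A * B) ^+ 2)%:E.

Lemma poweR_half_le (x : \bar R) (a : R) : 0 <= x -> (0 <= a)%R ->
  (x `^ 2^-1 <= a%:E) = (x <= (a ^+ 2)%:E).
Proof.
case: x => [r| |//] r0 a0; last by rewrite poweRyr.
rewrite poweR_EFin powR12_sqrt// !lee_fin -[RHS]ler_sqrt ?sqr_ge0//.
by rewrite sqrtr_sqr ger0_norm.
Qed.

Lemma modulus_ge0 (z : R[i]) : (0 <= modulus z)%R.
Proof. by case: z => a b /=; rewrite sqrtr_ge0. Qed.

Lemma modulus_real (x : R) : (0 <= x)%R -> modulus (real_complex R x) = x.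
Proof. by move=> x0; rewrite /= expr0n /= addr0 sqrtr_sqr ger0_norm. Qed.

Lemma modulus_sum (I : Type) (r : seq I) (F : I -> R[i]) :
  (modulus (\sum_(i <- r) F i) <= \sum_(i <- r) modulus (F i))%R.
Proof.
apply: (@big_ind2 _ _ (fun x y => modulus x <= y)%R) => //.
  by rewrite Normc.normc0.
by move=> x a y b xa yb; apply: le_trans (le_normcD x y) _; rewrite lerD.
Qed.

Lemma modulus_convolution_le f xi g :
  (modulus (convolution H f xi g))%:E <=
  nonneg_convolution (modulus \o f) (modulus \o xi) g.
Proof.
(* When infinitely many terms are nonzero, the finite-support sum takes the default value 0 and the
   bound is trivial; otherwise it is the triangle inequality. *)
rewrite /convolution; case: finite_supportP => [_|X XH _ _].
  rewrite big_nil Normc.normc0; apply: esum_ge0 => C _.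
  by rewrite lee_fin mulr_ge0 ?modulus_ge0.
apply: esum_ge; exists [set` X]; first by split; [exact: finite_fset|].
rewrite -fsbig_seq ?fset_uniq// sumEFin lee_fin.
apply: le_trans (modulus_sum _ _) _.
by apply: ler_sum => C _; rewrite Normc.normcM.
Qed.

(** Almost normality leaves finitely many cosets with a nonzero [phi] factor, so [convolution] is
    here a genuine sum and not the default 0. *)
Lemma nonneg_convolution_real phi u g : hecke_pair H ->
  (forall g, 0 <= phi g)%R -> hecke_algebra H (real_complex R \o phi) ->
  (forall g, 0 <= u g)%R ->
  nonneg_convolution phi u g =
  (modulus (convolution H (real_complex R \o phi) (real_complex R \o u) g))%:E.
Proof.
move=> [gH anH] phi0 Hphi u0.
set X := [set C | right_cosets H C /\ phi (g * (coset_repr C)^-1)%g != 0%R].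
have finX : finite_set X.
  have := finite_convolution_support gH g anH Hphi; apply: sub_finite_set.
  move=> C [rC fC]; split=> //=; apply: contraNneq fC => -[].
  by move=> ->.
have XE C : right_cosets H C -> ~ X C ->
    phi (g * (coset_repr C)^-1)%g = 0%R.
  by move=> rC nX; apply: contra_notP nX => /eqP.
have XH : X `<=` right_cosets H by move=> C [].
have -> : nonneg_convolution phi u g = \esum_(C in X)
    (phi (g * (coset_repr C)^-1)%g * u (coset_repr C))%:E.
  rewrite /nonneg_convolution (esumID X)//; last first.
    by move=> C _; rewrite lee_fin mulr_ge0.
  rewrite (setIidr XH) [X in _ + X]esum1 ?adde0// => C [rC nX].
  by rewrite XE// mul0r.
rewrite /convolution -(fsbig_widen X)//; last first.
  by move=> C [rC nX] /=; rewrite XE// rmorph0 mul0r.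
rewrite esum_fset//; last by move=> C _; rewrite lee_fin mulr_ge0.
rewrite !fsbig_finite// sumEFin. congr EFin.
rewrite -[LHS]modulus_real; last by rewrite sumr_ge0// => C _; rewrite mulr_ge0.
by rewrite rmorph_sum; congr modulus; apply: eq_bigr => C _; rewrite rmorphM.
Qed.

Lemma nonneg_decay_of_RD L : hecke_pair H -> property_RD H L ->
  exists K s : R, [/\ (0 < K)%R, (0 < s)%R & nonneg_decay L K s].
Proof.
move=> hH [K [s [K0 s0 RD]]]; exists K, s; split=> // phi u A B phi0 Hphi u0 uH.
move=> A0 B0 phiA uB.
have KA0 : (0 <= K * A)%R by rewrite mulr_ge0 // ltW.
(* [B = 0] excludes rescaling by [B], but then [u] vanishes on all representatives, and with it
   every convolution. *)
have [B00|Bn] := eqVneq B 0%R.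
  rewrite esum1; first by rewrite lee_fin sqr_ge0.
  move=> C _; rewrite /nonneg_convolution esum1 ?expe2 ?mule0// => D rD.
  move: uB; rewrite B00 expr0n/= => /esum_eq0/(_ D rD) e.
  have {e} [] : (u (coset_repr D) ^+ 2)%:E = 0 :> \bar R.
    by apply: e => ? _; rewrite lee_fin sqr_ge0.
  by move=> /eqP; rewrite sqrf_eq0 => /eqP ->; rewrite mulr0.
have {Bn}B1 : (0 < B)%R by rewrite lt_neqAle eq_sym Bn.
(* The operator norm only tests functions of norm at most 1, so [u] is scaled to [v]; linearity of
   the convolution in its second argument restores the factor [B]. *)
pose v g := (u g / B)%R.
have v0 g : (0 <= v g)%R by rewrite divr_ge0.
have wA : weighted_norm H s L (real_complex R \o phi) <= A%:E.
  rewrite /weighted_norm poweR_half_le//; last first.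
    apply: esum_ge0 => C _.
    by rewrite lee_fin mulr_ge0 ?sqr_ge0 ?powR_ge0.
  by under eq_esum do rewrite modulus_real//.
have nv : l2norm H (real_complex R \o v) <= 1.
  rewrite /l2norm -[1]/(1%:E) poweR_half_le//; last first.
    by apply: esum_ge0 => C _; rewrite lee_fin sqr_ge0.
  under eq_esum do rewrite modulus_real// /v exprMn mulrC EFinM.
  rewrite esumZl; first last.
  - by move=> C _; rewrite lee_fin sqr_ge0.
  - by rewrite lee_fin sqr_ge0.
  rewrite (le_trans (lee_wpmul2l _ uB)) ?lee_fin ?sqr_ge0//.
  by rewrite expr1n -exprMn mulVf ?expr1n// gt_eqF.
have lv : l2space H (real_complex R \o v).
  split; last by rewrite (le_lt_trans nv)// ltry.
  by move=> h g Hh; rewrite /= /v uH.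
have : l2norm H (convolution H (real_complex R \o phi) (real_complex R \o v))
    <= (K * A)%:E.
  apply: (@le_trans _ _ (regular_opnorm H (real_complex R \o phi))).
    by apply: ereal_sup_ubound; exists (real_complex R \o v).
  apply: le_trans (RD _ Hphi) _.
  by rewrite EFinM lee_wpmul2l// lee_fin ltW.
rewrite /l2norm poweR_half_le//; last first.
  by apply: esum_ge0 => C _; rewrite lee_fin sqr_ge0.
move=> le_conv.
have -> : ((K * A * B) ^+ 2)%:E = (B ^+ 2)%:E * ((K * A) ^+ 2)%:E.
  by rewrite exprMn mulrC EFinM.
apply: le_trans (lee_wpmul2l _ le_conv); last by rewrite lee_fin sqr_ge0.
rewrite -esumZl; first last.
- by move=> C _; rewrite lee_fin sqr_ge0.
- by rewrite lee_fin sqr_ge0.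
apply: le_esum => C _.
rewrite !EFin_expe -nonneg_convolution_real// !expe2 muleACA.
suff -> : nonneg_convolution phi u (coset_repr C) =
    B%:E * nonneg_convolution phi v (coset_repr C) by [].
rewrite /nonneg_convolution -esumZl ?lee_fin//; last first.
  by move=> D _; rewrite lee_fin mulr_ge0.
apply: eq_esum => D _; rewrite -EFinM; congr EFin.
by rewrite /v mulrCA [(B * _)%R]mulrC divfK// gt_eqF.
Qed.

(** Passing to moduli preserves both norms and membership in the Hecke algebra, and can only
    increase the modulus of the convolution. *)
Lemma RD_of_nonneg_decay L (K s : R) : (0 < K)%R -> (0 < s)%R ->
  nonneg_decay L K s -> property_RD H L.
Proof.
move=> K0 s0 dec; exists K, s; split=> // f Hf.
apply: ge_ereal_sup => _ [xi [[xiH _] xi1] <-].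
have w0 : 0 <= weighted_norm H s L f by exact: poweR_ge0.
(* An infinite weighted norm makes the bound trivial because [K > 0]; otherwise its real value
   serves as [A]. *)
have [woo|wfin] := eqVneq (weighted_norm H s L f) +oo.
  by rewrite woo gt0_muley ?leey// lte_fin.
have {}wfin : weighted_norm H s L f \is a fin_num.
  by rewrite ge0_fin_numE// lt_neqAle wfin leey.
rewrite -(fineK wfin); set A := fine _.
have A0 : (0 <= A)%R by exact: fine_ge0.
have wA : weighted_norm H s L f <= A%:E.
  by rewrite /A fineK.
have KA0 : (0 <= K * A)%R by rewrite mulr_ge0// ltW.
rewrite -EFinM /l2norm poweR_half_le//; last first.
  by apply: esum_ge0 => C _; rewrite lee_fin sqr_ge0.
rewrite -[(K * A)%R]mulr1.
have Hm : hecke_algebra H (real_complex R \o (modulus \o f)).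
  case: Hf => fH finf; split.
    by move=> h g k Hh Hk /=; rewrite fH.
  apply: sub_finite_set finf => _ [g /= fg <-]; exists g => //.
  by apply: contraNneq fg => /= ->; rewrite Normc.normc0.
apply: le_trans
  (dec (modulus \o f) (modulus \o xi) A 1%R _ Hm _ _ A0 _ _ _) => //.
- apply: le_esum => C _; rewrite EFin_expe.
  by rewrite !expe2 lee_pmul ?lee_fin ?modulus_ge0// modulus_convolution_le.
- by move=> g; exact: modulus_ge0.
- by move=> g; exact: modulus_ge0.
- by move=> h g Hh /=; rewrite xiH.
- move: wA; rewrite /weighted_norm poweR_half_le//.
  apply: esum_ge0 => C _.
  by rewrite lee_fin mulr_ge0 ?sqr_ge0 ?powR_ge0.
- move: xi1; rewrite /l2norm -[1]/(1%:E) poweR_half_le//.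
  by apply: esum_ge0 => C _; rewrite lee_fin sqr_ge0.
Qed.

End NonnegDecay.

(** * Sums over a group as sums over the cosets of its trivial subgroup *)

Section TrivialSubgroup.
Variables (R : realType) (Gamma : groupType).

Lemma hecke_pair_trivial : hecke_pair [set 1%g : Gamma].
Proof.
split=> [|g].
  split=> [|x y]; first exact/mem_set.
  by move=> /set_mem -> /set_mem ->; apply/mem_set; rewrite divgg.
exists [set g]; first exact: finite_set1.
rewrite bigcup_set1; apply/seteqP; split=> [_ [[h k] /= [-> ->] <-]|
    _ [h -> <-]].
  by exists 1%g => //; rewrite mul1g.
by exists (1%g, 1%g) => //=; rewrite mul1g.
Qed.

Lemma esum_trivial_cosets (e : Gamma -> Gamma) (F : Gamma -> \bar R) :
  bijective e ->
  (\esum_(C in right_cosets [set 1%g]) F (coset_repr C) =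
   \esum_(x in [set: Gamma]) F (e x))%E.
Proof.
move=> [e' eK e'K]; have [g1 _] := hecke_pair_trivial.
apply: (esum_right_cosets g1); last by move=> h g ->; rewrite mul1g.
split=> [x _|x y _ _ /(right_coset_eqP g1)[_ -> e1]|_ [x _ <-]].
- by exists (e x).
- by apply: (can_inj eK); rewrite e1 mul1g.
by exists (e' x) => //=; rewrite e'K.
Qed.

End TrivialSubgroup.

Lemma bi_invariant_real (R : realType) (G : groupType) (H : set G)
    (phi : G -> R) : hecke_algebra H (real_complex R \o phi) ->
  forall h g k, H h -> H k -> phi (h * g * k)%g = phi g.
Proof. by move=> [bi _] h g k Hh Hk; have [] := bi h g k Hh Hk. Qed.

Lemma length_invariant (R : realType) (G : groupType) (H : set G) (L : G -> R) :
  group_closed (mem H) -> hecke_length H L ->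
  forall h g, H h -> L (h * g)%g = L g.
Proof.
move=> gH [lL HL] h g Hh.
have L0 k : H k -> L k = 0 by move=> /HL.
apply/eqP; rewrite eq_le; apply/andP; split.
  by apply: le_trans (lengthM lL h g) _; rewrite L0// add0r.
rewrite -[in leLHS](mulKg h g).
apply: le_trans (lengthM lL _ _) _.
by rewrite (L0 _ (subgroupV gH Hh)) add0r.
Qed.

(** * Slices of functions on [H \ E] along the section *)

Section Extension.
Variables (R : realType) (G E Gamma : groupType).
Variables (iota : UMagmaMorphism.type G E) (pi : UMagmaMorphism.type E Gamma).
Variables (H : set G) (sigma : Gamma -> E).
Hypothesis hH : hecke_pair H.
Hypothesis extE : group_extension iota pi.
Hypothesis consH : consistent_section iota pi H sigma.

Let gH : group_closed (mem H) := hH.1.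
Let hE : hecke_pair (iota @` H) := hecke_pair_extension extE consH hH.
Let gE : group_closed (mem (iota @` H)) := hE.1.

Lemma pi_iota g : pi (iota g) = 1%g.
Proof.
have [_ kerE _] := extE; have : range iota (iota g) by exists g.
by rewrite kerE.
Qed.

Lemma section_conj gamma y : (iota @` H) y ->
  (iota @` H) (sigma gamma * y * (sigma gamma)^-1)%g.
Proof. by move=> Hy; rewrite -(consH.2 gamma); exists y. Qed.

Lemma section_conjV gamma y : (iota @` H) y ->
  (iota @` H) ((sigma gamma)^-1 * y * sigma gamma)%g.
Proof.
rewrite -{1}(consH.2 gamma) => -[z Hz <-].
by rewrite !mulgA mulgVK mulVg mul1g.
Qed.

(** The choice of representative is harmless, since [pi] is constant on each right coset of [H] in
    [E]. *)
Definition coset_fiber (gamma : Gamma) : set (set E) :=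
  [set C | right_cosets (iota @` H) C /\ pi (coset_repr C) = gamma].

Lemma pi_coset_repr x : pi (coset_repr (right_coset (iota @` H) x)) = pi x.
Proof.
have [_ [h _ <-] ->] := coset_repr_right_coset gE x.
by rewrite gmulfM pi_iota mul1g.
Qed.

(** [a] normalizes [H], so [a iota(H x) b = H a iota(x) b]. Surjectivity holds because [a^-1 y b^-1]
    lies in the kernel of [pi], the range of [iota], when [y] is over [pi a * pi b]. Taking [a = 1]
    gives the slices of a function, [a = (sigma delta)^-1] the terms of a convolution. *)
Lemma coset_fiber_bij (a b : E) :
  (forall y, (iota @` H) y -> (iota @` H) (a * y * a^-1)%g) ->
  (forall y, (iota @` H) y -> (iota @` H) (a^-1 * y * a)%g) ->
  set_bij (right_cosets H) (coset_fiber (pi a * pi b)%g)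
    (fun C => right_coset (iota @` H) (a * iota (coset_repr C) * b)%g).
Proof.
move=> na naV; have [inji kerE _] := extE; split.
- move=> C rC; split; first by eexists.
  by rewrite pi_coset_repr !gmulfM pi_iota mulg1.
- move=> C D /set_mem rC /set_mem rD /(right_coset_eqP gE)[y Hy].
  move/(congr1 (fun z => a^-1 * z * b^-1)%g);
  rewrite !mulgA !mulgK !mulVg !mul1g.
  move=> e; have [k Hk ek] := naV _ Hy.
  rewrite -(coset_reprK gH rC) -(coset_reprK gH rD).
  apply/(right_coset_eqP gH); exists k => //; apply: inji.
  by rewrite e gmulfM ek.
move=> C [[y _ <-]]; rewrite pi_coset_repr => py.
have [g _ eg] : range iota (a^-1 * y * b^-1)%g.
  by rewrite kerE /= !gmulfM py !gmulfV mulgA mulgK mulVg.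
exists (right_coset H g); first by exists g.
apply/esym/(right_coset_eqP gE); have [h Hh ->] := coset_repr_right_coset gH g.
exists (a * iota h * a^-1)%g; first by apply: na; exists h.
by rewrite gmulfM eg !mulgA mulgVK.
Qed.

Local Open Scope ereal_scope.

Lemma esum_coset_fiber (F : E -> \bar R) (a b : E) :
  (forall h x, (iota @` H) h -> F (h * x)%g = F x) ->
  (forall y, (iota @` H) y -> (iota @` H) (a * y * a^-1)%g) ->
  (forall y, (iota @` H) y -> (iota @` H) (a^-1 * y * a)%g) ->
  \esum_(C in coset_fiber (pi a * pi b)%g) F (coset_repr C) =
  \esum_(C in right_cosets H) F (a * iota (coset_repr C) * b)%g.
Proof.
move=> FH na naV.
exact: (esum_right_cosets gE (coset_fiber_bij b na naV) FH).
Qed.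

Lemma esum_section (F : E -> \bar R) gamma :
  (forall h x, (iota @` H) h -> F (h * x)%g = F x) ->
  \esum_(C in right_cosets H) F (iota (coset_repr C) * sigma gamma)%g =
  \esum_(C in coset_fiber gamma) F (coset_repr C).
Proof.
move=> FH; have := @esum_coset_fiber F 1%g (sigma gamma) FH.
rewrite gmulf1 consH.1.1 mul1g => ->.
- by apply: eq_esum => C _; rewrite mul1g.
- by move=> y Hy; rewrite invg1 mulg1 mul1g.
- by move=> y Hy; rewrite invg1 mulg1 mul1g.
Qed.

Lemma esum_fibers (F : set E -> \bar R) : (forall C, 0 <= F C) ->
  \esum_(C in right_cosets (iota @` H)) F C =
  \esum_(gamma in [set: Gamma]) \esum_(C in coset_fiber gamma) F C.
Proof.
move=> F0; rewrite esum_esum//.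
apply: (@reindex_esum _ _ _ _ _ (fun p : Gamma * set E => p.2)); split.
- by move=> [gamma C] [_ []].
- move=> [g1 C] [g2 D] /set_mem[_ [_ /= <-]] /set_mem[_ [_ /= <-]] /=.
  by move=> ->.
by move=> C rC; exists (pi (coset_repr C), C).
Qed.

(** Consistency of the section lets a factor [iota k] pass through [sigma delta] as another element
    of [H], whence right invariance. The double coset of [g] is the trace on the slice of that of
    [iota g * sigma delta], so finitely many occur. *)
Lemma hecke_algebra_section (phi : E -> R) delta :
  hecke_algebra (iota @` H) (real_complex R \o phi) ->
  hecke_algebra H (real_complex R \o
    (fun g => phi (iota g * sigma delta)%g)).
Proof.
move=> Hphi; have [_ finf] := Hphi; split=> [h g k Hh Hk /=|].
  have [k' Hk' ek] : (iota @` H) ((sigma delta)^-1 * iota k * sigma delta)%g.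
    by apply: section_conjV; exists k.
  congr (real_complex R _).
  have -> : (iota (h * g * k) * sigma delta =
      iota h * (iota g * sigma delta) * iota k')%g.
    by rewrite !gmulfM ek !mulgA mulgK.
  by apply: (bi_invariant_real Hphi); [exists h|exists k'].
apply: (@sub_finite_set _ _ ((fun D : set E =>
    [set g | D (iota g * sigma delta)%g]) @`
    [set double_coset (iota @` H) g | g in
      [set g | (real_complex R \o phi) g != 0%R]])); last exact: finite_image.
move=> _ [g /= phig <-].
exists (double_coset (iota @` H) (iota g * sigma delta)%g).
  by exists (iota g * sigma delta)%g.
have [inji _ _] := extE.
apply/seteqP; split=> [x [[_ _] [/= [h Hh <-] [k Hk <-]] e]|
    _ [[h k] /= [Hh Hk] <-]].
  have [k' Hk' ek] : (iota @` H) (sigma delta * iota k * (sigma delta)^-1)%g.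
    by apply: section_conj; exists k.
  exists (h, k') => //=; apply: inji; apply: (@mulIg _ (sigma delta)).
  by rewrite -e !gmulfM ek !mulgA mulgVK.
have [k' Hk' ek] : (iota @` H) ((sigma delta)^-1 * iota k * sigma delta)%g.
  by apply: section_conjV; exists k.
exists (iota h, iota k') => /=; first by split; [exists h|exists k'].
by rewrite ek !gmulfM !mulgA mulgK.
Qed.

(** [pi] is constant on double cosets of [H] in [E], so the support of [a] is covered by the images
    of the finitely many double cosets where [phi] is nonzero. *)
Lemma hecke_algebra_quotient (phi : E -> R) (a : Gamma -> R) :
  hecke_algebra (iota @` H) (real_complex R \o phi) ->
  (forall delta, a delta != 0%R ->
    exists g, phi (iota g * sigma delta)%g != 0%R) ->
  hecke_algebra [set 1%g] (real_complex R \o a).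
Proof.
move=> [_ finf] supp; split=> [h g k /= -> ->|]; first by rewrite mul1g mulg1.
apply: (@sub_finite_set _ _ ((fun D => double_coset [set 1%g] (pi (xget 1%g D)))
   @` [set double_coset (iota @` H) g | g in
      [set g | (real_complex R \o phi) g != 0%R]])); last exact: finite_image.
move=> _ [delta /= ad <-].
have [g phig] : exists g, phi (iota g * sigma delta)%g != 0%R.
  by apply: supp; apply: contraNneq ad => ->.
exists (double_coset (iota @` H) (iota g * sigma delta)%g).
  exists (iota g * sigma delta)%g => //=.
  by apply: contraNneq phig => -[->].
have := double_coset_refl gE (iota g * sigma delta)%g.
move=> /(xgetI 1%g) [[_ _] [/= [h _ <-] [k _ <-]] <-].
by rewrite !gmulfM !pi_iota !mul1g mulg1 consH.1.1.
Qed.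

(* [(C, delta) |-> (sigma delta)^-1 C (sigma gamma)] enumerates [H \ E] in such
   a way that [x y^-1] becomes [(g C^-1) (sigma delta)] for
   [x = g (sigma gamma)], so that no cocycle appears. *)
Lemma nonneg_convolution_section (phi u : E -> R) g gamma :
  (forall x, 0 <= phi x)%R ->
  hecke_algebra (iota @` H) (real_complex R \o phi) ->
  (forall x, 0 <= u x)%R ->
  (forall h x, (iota @` H) h -> u (h * x)%g = u x) ->
  nonneg_convolution (iota @` H) phi u (iota g * sigma gamma)%g =
  \esum_(delta in [set: Gamma])
    nonneg_convolution H (fun x => phi (iota x * sigma delta)%g)
      (fun x => u ((sigma delta)^-1 * iota x * sigma gamma)%g) g.
Proof.
move=> phi0 Hphi u0 uH; set x := (iota g * _)%g.
pose F y := (phi (x * y^-1)%g * u y)%:E.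
have F0 y : 0 <= F y by rewrite lee_fin mulr_ge0.
have FH h y : (iota @` H) h -> F (h * y)%g = F y.
  move=> Hh; rewrite /F uH// invgM; congr (_ * _)%:E.
  have := bi_invariant_real Hphi (x * y^-1)%g (subgroup1 gE) (subgroupV gE Hh).
  by rewrite mul1g -mulgA.
rewrite /nonneg_convolution esum_fibers; last by move=> C; exact: F0.
have bij : set_bij [set: Gamma] [set: Gamma] (fun delta => delta^-1 * gamma)%g.
  rewrite setTT_bijective; exists (fun d => gamma * d^-1)%g => d.
    by rewrite invgM invgK mulVKg.
  by rewrite invgM invgK mulgVK.
rewrite (@reindex_esum _ _ _ _ _ _ _ bij); apply: eq_esum => delta _.
have := @esum_coset_fiber F (sigma delta)^-1%g (sigma gamma) FH.
rewrite gmulfV !consH.1.1 => ->.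
- apply: eq_esum => C _; rewrite /F /x; congr (phi _ * _)%:E.
  by rewrite !invgM !invgK gmulfM gmulfV !mulgA mulgK.
- by move=> y Hy; rewrite invgK; exact: section_conjV.
- by move=> y Hy; rewrite invgK; exact: section_conj.
Qed.

Lemma nonneg_convolution_invariant (phi u : E -> R) h x :
  hecke_algebra (iota @` H) (real_complex R \o phi) -> (iota @` H) h ->
  nonneg_convolution (iota @` H) phi u (h * x)%g =
  nonneg_convolution (iota @` H) phi u x.
Proof.
move=> Hphi Hh; apply: eq_esum => C _; congr (_ * _)%:E.
have := bi_invariant_real Hphi (x * (coset_repr C)^-1)%g Hh (subgroup1 gE).
by rewrite mulg1 mulgA.
Qed.

End Extension.

(** * Comparison of weights and the two successive uses of (RD) *)

(** Both [1 + l0] and [1 + l1] are at most [m], as [1 + l0 + l1 <= 1 + c l^e <= (1 + c) (1 + l)^e];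
    the right-hand side is [m] to the power [2 s0 + 2 s1]. *)
Lemma weight_le (R : realType) (c e s0 s1 l0 l1 l : R) :
  0 < c -> 0 < e -> 0 < s0 -> 0 < s1 -> 0 <= l0 -> 0 <= l1 -> 0 <= l ->
  l0 + l1 <= c * l `^ e ->
  (1 + l0) `^ (2 * s0) * (1 + l1) `^ (2 * s1) <=
  ((1 + c) `^ (s0 + s1)) ^+ 2 * (1 + l) `^ (2 * (e * (s0 + s1))).
Proof.
move=> c0 e0 s00 s10 l00 l10 l0' ll.
pose m := (1 + c) * (1 + l) `^ e.
have le1 : 1 <= (1 + l) `^ e.
  by rewrite -[leLHS](powRr0 (1 + l)); apply: ler_powR; rewrite ?lerDl// ltW.
have le2 : l `^ e <= (1 + l) `^ e.
  by apply: ge0_ler_powR; rewrite ?nnegrE ?addr_ge0 ?lerDr// ltW.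
have ml : 1 + (l0 + l1) <= m.
  rewrite /m mulrDl mul1r lerD//; apply: le_trans ll _.
  by rewrite ler_wpM2l// ltW.
have m0 : 0 <= m by rewrite /m mulr_ge0 ?powR_ge0// addr_ge0// ltW.
have le0 : 1 + l0 <= m by apply: le_trans ml; rewrite addrA lerDl.
have le1' : 1 + l1 <= m by apply: le_trans ml; rewrite lerD2l lerDr.
have -> : ((1 + c) `^ (s0 + s1)) ^+ 2 * (1 + l) `^ (2 * (e * (s0 + s1))) =
    m `^ (2 * s0) * m `^ (2 * s1).
  rewrite -powRD; last first.
    apply/implyP => _; rewrite gt_eqF// (lt_le_trans _ ml)// ltr_wpDr//.
    exact: addr_ge0.
  rewrite /m powRM ?powR_ge0//; last by rewrite addr_ge0// ltW.
  rewrite -powR_mulrn ?powR_ge0// -!powRrM.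
  by congr (_ `^ _ * _ `^ _); ring.
by rewrite ler_pM ?powR_ge0//; apply: ge0_ler_powR;
  rewrite ?nnegrE ?addr_ge0// mulr_ge0// ltW.
Qed.

Theorem proposition3p4 (R : realType) (G E Gamma : groupType)
    (H : set G) (iota : UMagmaMorphism.type G E)
    (pi : UMagmaMorphism.type E Gamma) (sigma : Gamma -> E)
    (L0 : G -> R) (L : E -> R) (L1 : Gamma -> R) :
  hecke_pair H ->
  group_extension iota pi ->
  consistent_section iota pi H sigma ->
  hecke_length H L0 ->
  hecke_length (iota @` H) L ->
  length_function L1 ->
  property_RD H L0 ->
  group_RD L1 ->
  (exists c e : R, [/\ 0 < c, 0 < e & forall x : G * Gamma,
     L0 x.1 + L1 x.2 <= c * L (Esigma_val iota sigma x) `^ e]) ->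
  property_RD (iota @` H) L.
Proof.
move=> hH extE consH hL0 hL hL1 RD0 RD1 [c [e [c0 e0 Lle]]].
have gH := hH.1.
have hE := hecke_pair_extension extE consH hH; have gE := hE.1.
have [K0 [s0 [K00 s00 dec0]]] := nonneg_decay_of_RD hH RD0.
have [K1 [s1 [K10 s10 dec1]]] :=
  nonneg_decay_of_RD (hecke_pair_trivial Gamma) RD1.
pose M := (1 + c) `^ (s0 + s1).
have M0 : 0 < M by rewrite powR_gt0// ltr_wpDr// ltW.
(* [K0] and [K1] come from the two uses of (RD); [M] and the exponent come from [weight_le]. *)
apply: (@RD_of_nonneg_decay _ _ _ _ (K0 * (K1 * M)) (e * (s0 + s1))).
- by rewrite !mulr_gt0.
- by rewrite mulr_gt0// addr_gt0.
move=> phi u A B phi0 Hphi u0 uH A0 B0 phiA uB.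
pose phis delta x := phi (iota x * sigma delta)%g.
pose w0 x := (1 + L0 x) `^ (2 * s0).
pose w1 delta := (1 + L1 delta) `^ (2 * s1).
(* [SA] and [SB] are the squared slice norms, a priori in [0, +oo]; their finiteness, shown below,
   makes [a] and [b] the actual norms. *)
pose SA delta : \bar R := (\esum_(C in right_cosets H)
  (phis delta (coset_repr C) ^+ 2 * w0 (coset_repr C))%:E)%E.
pose SB gamma : \bar R :=
  (\esum_(C in coset_fiber iota pi H gamma) (u (coset_repr C) ^+ 2)%:E)%E.
pose a delta := Num.sqrt (fine (SA delta)).
pose b gamma := Num.sqrt (fine (SB gamma)).
have w00 x : 0 <= w0 x by exact: powR_ge0.
have w10 x : 0 <= w1 x by exact: powR_ge0.
have w11 x : 1 <= w1 x.
  rewrite -[leLHS](powRr0 (1 + L1 x)); apply: ler_powR.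
    by rewrite lerDl (length_ge0 hL1).
  by rewrite mulr_ge0// ltW.
have SA0 delta : (0 <= SA delta)%E.
  by apply: esum_ge0 => C _; rewrite lee_fin mulr_ge0// sqr_ge0.
have SB0 gamma : (0 <= SB gamma)%E.
  by apply: esum_ge0 => C _; rewrite lee_fin sqr_ge0.
have MA0 : 0 <= M * A by rewrite mulr_ge0// ltW.
(* The only use of the comparison of lengths: on each coset [weight_le] trades [w0] times [w1] for
   the weight of [L], and summing over the fibers restores the norm of [phi]. *)
have sumA : (\esum_(delta in [set: Gamma]) ((w1 delta)%:E * SA delta) <=
    ((M * A) ^+ 2)%:E)%E.
  pose F x := (phi x ^+ 2 * (1 + L x) `^ (2 * (e * (s0 + s1))))%:E.
  have F0 x : (0 <= F x)%E by rewrite lee_fin mulr_ge0 ?sqr_ge0 ?powR_ge0.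
  have FH h x : (iota @` H) h -> F (h * x)%g = F x.
    move=> Hh; rewrite /F (length_invariant gE hL)//.
    by have := bi_invariant_real Hphi x Hh (subgroup1 gE); rewrite mulg1 => ->.
  apply: (@le_trans _ _ (\esum_(delta in [set: Gamma])
      ((M ^+ 2)%:E * \esum_(C in coset_fiber iota pi H delta)
         F (coset_repr C)))%E).
    apply: le_esum => delta _.
    rewrite -(esum_section hH extE consH delta FH) /SA.
    rewrite -!esumZl ?lee_fin ?sqr_ge0//; last first.
      by move=> C _; rewrite lee_fin mulr_ge0// sqr_ge0.
    apply: le_esum => C _; rewrite /F -!EFinM lee_fin.
    rewrite mulrCA [leRHS]mulrCA ler_wpM2l ?sqr_ge0// mulrC.
    apply: weight_le => //.
    - exact: length_ge0 hL0.1 _.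
    - exact: length_ge0 hL1 _.
    - exact: length_ge0 hL.1 _.
    - exact: (Lle (coset_repr C, delta)).
  rewrite esumZl; first last.
  - by move=> delta _; apply: esum_ge0.
  - by rewrite lee_fin sqr_ge0.
  rewrite -(@esum_fibers _ _ _ _ iota pi H (fun C => F (coset_repr C)))//.
  by rewrite exprMn [leRHS]EFinM lee_wpmul2l// lee_fin sqr_ge0.
(* Since [w1 >= 1], [SA delta] is at most a single term of the sum that [sumA] bounds. *)
have SAfin delta : SA delta \is a fin_num.
  rewrite ge0_fin_numE//; apply: le_lt_trans (ltry ((M * A) ^+ 2)).
  apply: le_trans sumA.
  apply: le_trans (@esum_ge_term _ _ _ _ delta _ _) => //.
    by rewrite -[leLHS]mul1e lee_wpmul2r// lee_fin.
  by move=> d _; rewrite mule_ge0// lee_fin.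
have aE delta : (a delta ^+ 2)%:E = SA delta.
  by rewrite sqr_sqrtr ?fine_ge0// fineK.
have sumB : (\esum_(gamma in [set: Gamma]) SB gamma <= (B ^+ 2)%:E)%E.
  rewrite /SB -(@esum_fibers _ _ _ _ iota pi H
    (fun C => (u (coset_repr C) ^+ 2)%:E))//.
  by move=> C; rewrite lee_fin sqr_ge0.
have SBfin gamma : SB gamma \is a fin_num.
  rewrite ge0_fin_numE//; apply: le_lt_trans (ltry (B ^+ 2)).
  by apply: le_trans sumB; exact: esum_ge_term.
have bE gamma : (b gamma ^+ 2)%:E = SB gamma.
  by rewrite sqr_sqrtr ?fine_ge0// fineK.
have a0 delta : 0 <= a delta by exact: sqrtr_ge0.
have b0 gamma : 0 <= b gamma by exact: sqrtr_ge0.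
have phisH delta : hecke_algebra H (real_complex R \o phis delta).
  exact: (hecke_algebra_section extE consH).
have Ha : hecke_algebra [set 1%g] (real_complex R \o a).
  apply: (hecke_algebra_quotient hH extE consH Hphi) => delta.
  (* Contrapositive: where the slice of [phi] vanishes identically, its norm [a delta] is 0. *)
  apply: contra_neqP => /forallNP nphi.
  rewrite /a /SA esum1 ?sqrtr0// => C _.
  by have /negP := nphi (coset_repr C); rewrite negbK /phis => /eqP ->;
     rewrite expr0n mul0r.
have inner g gamma :
  (nonneg_convolution (iota @` H) phi u (iota g * sigma gamma)%g =
   \esum_(delta in [set: Gamma]) nonneg_convolution H (phis delta)
      (fun x => u ((sigma delta)^-1 * iota x * sigma gamma)%g) g)%E.
  exact: (nonneg_convolution_section hH extE consH).
(* Minkowski bounds the norm of the sum over [delta] by the sum of the norms, each at most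
   [K0 * a delta * b (delta^-1 * gamma)] by [dec0]; these add up to [K0] times the convolution of
   [a] and [b] on [Gamma]. *)
have slice gamma : (\esum_(C in right_cosets H) nonneg_convolution (iota @` H)
      phi u (iota (coset_repr C) * sigma gamma)%g ^+ 2 <=
    (K0 ^+ 2)%:E * nonneg_convolution [set 1%g] a b gamma ^+ 2)%E.
  under eq_esum do rewrite inner.
  have abE : nonneg_convolution [set 1%g] a b gamma =
      (\esum_(delta in [set: Gamma]) (a delta * b (delta^-1 * gamma)%g)%:E)%E.
    rewrite /nonneg_convolution (@esum_trivial_cosets _ _
      (fun delta => delta^-1 * gamma)%g
      (fun x => (a (gamma * x^-1)%g * b x)%:E)).
      by apply: eq_esum => d _; rewrite invgM invgK mulVKg.
    exists (fun d => gamma * d^-1)%g => d.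
      by rewrite invgM invgK mulVKg.
    by rewrite invgM invgK mulgVK.
  have -> : ((K0 ^+ 2)%:E * nonneg_convolution [set 1%g] a b gamma ^+ 2 =
    (\esum_(delta in [set: Gamma])
       (K0 * a delta * b (delta^-1 * gamma)%g)%:E) ^+ 2)%E.
    under [in RHS]eq_esum do rewrite -mulrA EFinM.
    rewrite esumZl ?lee_fin ?ltW//; last first.
      by move=> d _; rewrite lee_fin mulr_ge0.
    by rewrite abE EFin_expe !expe2 muleACA.
  apply: esum_minkowski => [d C|d|d _].
  - by apply: esum_ge0 => D _; rewrite lee_fin mulr_ge0// /phis.
  - by rewrite !mulr_ge0// ltW.
  apply: dec0 => //.
  - by move=> g; rewrite /phis.
  (* Moved to the left past [(sigma d)^-1], [iota h] becomes [iota h'] with [h'] in [H], which [u]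
     absorbs. *)
  - move=> h g Hh.
    have [h' Hh' eh] : (iota @` H)
        ((sigma d)^-1 * iota h * sigma d)%g.
      by apply: (section_conjV consH); exists h.
    have -> : ((sigma d)^-1 * iota (h * g) * sigma gamma =
        iota h' * ((sigma d)^-1 * iota g * sigma gamma))%g.
      by rewrite eh gmulfM !mulgA mulgK.
    by rewrite uH//; exists h'.
  - by rewrite aE /SA.
  rewrite bE /SB.
  (* The translated function runs over the slice of [u] at [d^-1 * gamma], so its norm is
     [b (d^-1 * gamma)]. *)
  have := @esum_coset_fiber R _ _ _ _ _ _ _ hH extE consH
    (fun x => (u x ^+ 2)%:E) (sigma d)^-1%g (sigma gamma).
  rewrite gmulfV !consH.1.1 => <- //.
  - by move=> h x Hh; rewrite uH.
  - by move=> y Hy; rewrite invgK; exact: (section_conjV consH).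
  - by move=> y Hy; rewrite invgK; exact: (section_conj consH).
pose F x := (nonneg_convolution (iota @` H) phi u x ^+ 2)%E.
have F0 x : (0 <= F x)%E.
  by rewrite expe_ge0// esum_ge0// => C _; rewrite lee_fin mulr_ge0.
have FH h x : (iota @` H) h -> F (h * x)%g = F x.
  by move=> Hh; rewrite /F (nonneg_convolution_invariant hH extE consH).
rewrite -/(F _) (@esum_fibers _ _ _ _ iota pi H (fun C => F (coset_repr C)))//.
apply: (@le_trans _ _ (\esum_(gamma in [set: Gamma])
    ((K0 ^+ 2)%:E * nonneg_convolution [set 1%g] a b gamma ^+ 2))%E).
  apply: le_esum => gamma _.
  by rewrite -(esum_section hH extE consH gamma FH); exact: slice.
rewrite esumZl ?lee_fin ?sqr_ge0//; last first.
  move=> gamma _; rewrite expe_ge0// esum_ge0// => C _.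
  by rewrite lee_fin mulr_ge0.
rewrite -(@esum_trivial_cosets _ _ id
  (fun x => nonneg_convolution [set 1%g] a b x ^+ 2)%E); last by exists id.
(* (RD) of [Gamma] for [a] and [b], with the norm bounds [M * A] from [sumA] and [B] from [sumB]. *)
apply: (@le_trans _ _ ((K0 ^+ 2)%:E * ((K1 * (M * A) * B) ^+ 2)%:E)%E).
  rewrite lee_wpmul2l ?lee_fin ?sqr_ge0//.
  apply: dec1 => //.
  - by move=> h g ->; rewrite mul1g.
  - rewrite (@esum_trivial_cosets _ _ id
      (fun x => (a x ^+ 2 * w1 x)%:E)); last by exists id.
    by under eq_esum do rewrite mulrC EFinM aE.
  - rewrite (@esum_trivial_cosets _ _ id (fun x => (b x ^+ 2)%:E)).
      by under eq_esum do rewrite bE.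
    by exists id.
by rewrite -EFinM lee_fin -exprMn !mulrA.
Qed.
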